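(* A left quasigroup $Q$ is superconnected if and only if $\mathcal P_2\notin \mathbf{H}\mathbf{S}(Q)$, i.e. if and only if no subalgebra of $Q$ has a homomorphic image isomorphic to $\mathcal P_2$.
   Context: A left quasigroup is an algebra $(Q,*,\backslash)$ satisfying $x\backslash(x*y)=y=x*(x\backslash y)$; equivalently every left multiplication $L_a:b\mapsto a*b$ is a bijection of $Q$. $\mathrm{LMlt}(Q)=\langle L_a:a\in Q\rangle$. $Q$ is connected if $\mathrm{LMlt}(Q)$ is transitive on $Q$, and superconnected if every subalgebra (subset closed under $*$ and $\backslash$) is connected with respect to its own left multiplication group. $\mathcal P_2$ is the two-element projection left quasigroup, i.e. with operation $a*b=b$ (and $a\backslash b=b$). $\mathbf H$ and $\mathbf S$ denote the operators of taking homomorphic images and subalgebras, up to isomorphism; $\mathbf H\mathbf S(Q)$ consists of the homomorphic images of subalgebras of $Q$. *)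

(* Defs.v *)
From HB Require Import structures.
From mathcomp Require Import all_boot.
From mathcomp Require Import boolp classical_sets.

Set Implicit Arguments.
Unset Strict Implicit.
Unset Printing Implicit Defensive.

Local Open Scope classical_set_scope.
Local Open Scope group_scope.

(* The product [x * y] is that of the library's magmas; [ldiv x y] is x \ y.
   The carrier is an arbitrary type: it may be infinite, and may be empty. *)
HB.mixin Record Magma_isLeftQuasigroup Q of Magma Q := {
  ldiv : Q -> Q -> Q;
  mulKq : forall x y : Q, ldiv x (x * y) = y;
  ldivKq : forall x y : Q, x * ldiv x y = y
}.

#[short(type="leftQuasigroupType")]
HB.structure Definition LeftQuasigroup :=
  {Q of Magma_isLeftQuasigroup Q & Magma Q}.

Definition lmul (Q : leftQuasigroupType) (a : Q) : Q -> Q := fun b => a * b.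

(* When every element of [G] is a bijection, [gen_perm G] is the subgroup of
   Sym(T) generated by [G]; inverses are given by [cancel]. *)
Inductive gen_perm (T : Type) (G : set (T -> T)) : set (T -> T) :=
| gen_perm_gen f of G f : gen_perm G f
| gen_perm_id : gen_perm G id
| gen_perm_comp f g of gen_perm G f & gen_perm G g : gen_perm G (f \o g)
| gen_perm_inv f g of gen_perm G f & cancel f g & cancel g f : gen_perm G g.

Definition LMlt (Q : leftQuasigroupType) : set (Q -> Q) :=
  gen_perm (range (@lmul Q)).
Arguments LMlt : clear implicits.

Definition connected (Q : leftQuasigroupType) : Prop :=
  forall x y : Q, exists2 f, LMlt Q f & f x = y.

Record subalgebra (Q : leftQuasigroupType) := Subalgebra {
  subalg_set :> set Q;
  subalg_mul : forall x y, subalg_set x -> subalg_set y -> subalg_set (x * y);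
  subalg_ldiv :
    forall x y, subalg_set x -> subalg_set y -> subalg_set (ldiv x y)
}.

Definition subalg_type (Q : leftQuasigroupType) (S : subalgebra Q) : Type :=
  set_type S.

Section SubalgebraStructure.
Variables (Q : leftQuasigroupType) (S : subalgebra Q).
Implicit Types x y : subalg_type S.

Definition sub_mul x y : subalg_type S :=
  exist _ (val x * val y)
    (mem_set (subalg_mul (set_mem (valP x)) (set_mem (valP y)))).

Definition sub_ldiv x y : subalg_type S :=
  exist _ (ldiv (val x) (val y))
    (mem_set (subalg_ldiv (set_mem (valP x)) (set_mem (valP y)))).

HB.instance Definition _ := hasMul.Build (subalg_type S) sub_mul.

Fact sub_mulKq x y : sub_ldiv x (x * y) = y.
Proof. by apply: val_inj; rewrite /= mulKq. Qed.

Fact sub_ldivKq x y : x * sub_ldiv x y = y.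
Proof. by apply: val_inj; rewrite /= ldivKq. Qed.

HB.instance Definition _ :=
  Magma_isLeftQuasigroup.Build (subalg_type S) sub_mulKq sub_ldivKq.
End SubalgebraStructure.

Definition superconnected (Q : leftQuasigroupType) : Prop :=
  forall S : subalgebra Q, connected (subalg_type S).

Definition proj2_type : Type := bool.
HB.instance Definition _ := hasMul.Build proj2_type (fun _ b => b).
HB.instance Definition _ := @Magma_isLeftQuasigroup.Build proj2_type
  (fun _ b => b) (fun _ _ => erefl) (fun _ _ => erefl).

Definition P2 : leftQuasigroupType := proj2_type.

Definition lq_hom (Q R : leftQuasigroupType) (f : Q -> R) : Prop :=
  {morph f : x y / x * y} /\ {morph f : x y / ldiv x y}.

Definition lq_isomorphic (Q R : leftQuasigroupType) : Prop :=
  exists2 f : Q -> R, lq_hom f & bijective f.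

(* Classes are predicates: [set leftQuasigroupType] is a universe
   inconsistency. *)
Definition lq_class := leftQuasigroupType -> Prop.

(* [H_op K] is closed under isomorphism: the surjection onto [R] need not be a
   canonical quotient map. *)
Definition H_op (K : lq_class) : lq_class := fun R =>
  exists2 Q, K Q & exists2 f : Q -> R, lq_hom f & range f = setT.

Definition S_op (K : lq_class) : lq_class := fun R =>
  exists2 Q, K Q & exists S : subalgebra Q, lq_isomorphic (subalg_type S) R.

Definition HS (Q : leftQuasigroupType) : lq_class := H_op (S_op (eq Q)).

(* Main.v *)
From mathcomp Require Import all_boot.
From mathcomp Require Import boolp classical_sets.
Require Import Defs.

(** In the projection left quasigroup every left multiplication is the
    identity, so a map [h] to [P2] is a homomorphism exactly when it is
    invariant under all left multiplications, that is, constant on the orbits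
    of the left multiplication group. Hence a left quasigroup has a surjective
    homomorphism onto [P2] if and only if that group has at least two orbits:
    given two orbits, the indicator function of one of them is such a
    homomorphism ([connectedP]). The theorem applies this criterion to every
    subalgebra; closing under isomorphism between the operators [S] and [H]
    adds nothing, because surjective homomorphisms compose. *)

Local Open Scope classical_set_scope.
Local Open Scope group_scope.

Lemma gen_perm_invariant (T U : Type) (G : set (T -> T)) (h : T -> U) :
  (forall g, G g -> forall x, h (g x) = h x) ->
  forall f, gen_perm G f -> forall x, h (f x) = h x.
Proof.
move=> hG f; elim=> {f} [f Gf|//|f g _ hf _ hg|f g _ hf _ gK] x.
- exact: hG.
- by rewrite /= hf hg.
- by rewrite -hf gK.
Qed.

(** The clause about [ldiv] comes for free: [x * ldiv x y = y], so invariance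
    under multiplication by [x] already gives it. *)
Lemma hom_P2P (R : leftQuasigroupType) (h : R -> P2) :
  lq_hom h <-> forall x y : R, h (x * y) = h y.
Proof.
split=> [[hM _] x y|hM]; first by rewrite hM.
by split=> x y; [rewrite hM | rewrite -[in RHS](ldivKq x y) hM].
Qed.

Lemma connectedP (R : leftQuasigroupType) :
  connected R <-> ~ exists2 h : R -> P2, lq_hom h & range h = setT.
Proof.
split=> [conR [h /hom_P2P hM h_surj]|noP2 x y].
  have [x _ hx] : range h true by rewrite h_surj.
  have [y _ hy] : range h false by rewrite h_surj.
  have [f Lf fxy] := conR x y.
  have hf : h (f x) = h x.
    by apply: gen_perm_invariant Lf _ => _ [a _ <-] z; exact: hM.
  by move: hf; rewrite fxy hx hy.
apply: contrapT => xNy; apply: noP2.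
pose orbit_x z := exists2 f, LMlt R f & f x = z.
exists (fun z => `[< orbit_x z >] : P2).
  have Lmul (a : R) : LMlt R (lmul a) by apply: gen_perm_gen; exists a.
  apply/hom_P2P => a z; apply: asbool_equiv_eq; split=> -[f Lf fx].
    exists (ldiv a \o f); last by rewrite /= fx mulKq.
    apply: gen_perm_comp Lf; apply: gen_perm_inv (Lmul a) _ _ => t.
      exact: mulKq.
    exact: ldivKq.
  by exists (lmul a \o f); [exact: gen_perm_comp (Lmul a) Lf | rewrite /= fx].
apply/seteqP; split=> // -[] _.
  exists x => //; apply: asboolT.
  by exists id; first exact: gen_perm_id.
by exists y => //; exact: asboolF.
Qed.

Lemma HS_P2P (Q : leftQuasigroupType) :
  HS Q P2 <-> exists S : subalgebra Q,
    exists2 h : subalg_type S -> P2, lq_hom h & range h = setT.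
Proof.
split=> [[R [_ <- [S [i [iM iV] [j _ jK]]]] [h [hM hV] h_surj]]|[S hS]].
  exists S, (h \o i); first by split=> x y /=; rewrite ?iM ?hM ?iV ?hV.
  apply/seteqP; split=> // b _.
  have [z _ <-] : range h b by rewrite h_surj.
  by exists (j z) => //=; rewrite jK.
exists (subalg_type S) => //; exists Q => //; exists S, id => //.
by exists id.
Qed.

Theorem corollary1p6 (Q : leftQuasigroupType) :
  superconnected Q <-> ~ HS Q P2.
Proof.
split=> [supQ /HS_P2P[S]|noP2 S]; first exact: (connectedP _).1 (supQ S).
by apply/connectedP => hS; apply: noP2; apply/HS_P2P; exists S.
Qed.
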